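(* Fix integers $d\geq1$, $k\geq 2$ and a point $x^0\in[0,1)^d$, and use the notation below. Let $q \in \beta \mathbb{N}_0$ be a minimal idempotent, $p \in \beta \mathbb{N}_0 + q$, let $S \subset [0,1)^d$ be a semialgebraic set and suppose that $x^n \in S$ for $p$-almost all $n$. Then the set of $l \in \mathbb{N}$ such that $\{l x^n\} \in S$ for $q$-almost all $n$ is $\mathrm{IP}^*_+$.
   Context: $\{y\}$ is the coordinatewise fractional part. $\beta\mathbb{N}_0$ is the space of ultrafilters on $\mathbb{N}_0$ with addition $E\in p+q$ iff $\{n:\{m:n+m\in E\}\in q\}\in p$; $q$ is idempotent if $q+q=q$ and minimal if $\beta\mathbb{N}_0+q$ is a minimal left ideal. Put $x^n:=\{k^nx^0\}$ for $n\in\mathbb{N}_0$. ''$p$-almost all $n$'' means the set of such $n$ lies in $p$. Semialgebraic sets are finite unions of sets defined by finitely many polynomial equations and strict inequalities. A set is $\mathrm{IP}$ if it contains all finite nonempty sums of some sequence in $\mathbb{N}$, $\mathrm{IP}^*$ if it meets every $\mathrm{IP}$ set, $\mathrm{IP}^*_+$ if some translate of it is $\mathrm{IP}^*$. *)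

(* Defs.v *)
From HB Require Import structures.
From mathcomp Require Import all_boot all_order all_algebra finmap mpoly.
From mathcomp Require Import mathcomp_extra boolp classical_sets filter reals.

Set Implicit Arguments.
Unset Strict Implicit.
Unset Printing Implicit Defensive.

Import Order.TTheory GRing.Theory Num.Theory.

Local Open Scope classical_set_scope.
Local Open Scope ring_scope.

(* A point of beta N_0 is a [set_system nat] satisfying [UltraFilter], so that
   equality of ultrafilters is equality of set systems. *)
Definition betaN0 : set (set_system nat) := [set p | UltraFilter p].

Definition uadd (p q : set_system nat) : set_system nat :=
  [set E | p [set n | q [set m | E (n + m)%N]]].

(* Not used in the definitions below: [uadd] is an operation on beta N_0. *)
Lemma uadd_betaN0 p q : betaN0 p -> betaN0 q -> betaN0 (uadd p q).
Proof.
rewrite /betaN0 /= => pU qU.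
have F : ProperFilter (uadd p q).
  have Fuadd : Filter (uadd p q).
    split.
    - by apply: (@filterS _ p) filterT => n _; exact: filterT.
    - move=> A B pA pB; apply: (@filterS2 _ p) pA pB => n /= qA qB.
      exact: filterI.
    - move=> A B AB; apply: (@filterS _ p) => n /=; apply: filterS => m /=.
      exact: AB.
  split => // h; apply: (@filter_not_empty _ p _).
  by apply: (@filterS _ p) h => n /= /filter_not_empty.
split=> // G GF sG; apply/seteqP; split => // A GA.
have [//|npA] := in_ultra_setVsetC [set n | q [set m | A (n + m)%N]] pU.
exfalso; apply: (@filter_not_empty _ G _).
have GnA : G (~` A).
  apply: sG; apply: (@filterS _ p) npA => n /= nqA.
  by have [//|] := in_ultra_setVsetC [set m | A (n + m)%N] qU.
by rewrite -(setICr A); exact: filterI.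
Qed.

Definition left_ideal (L : set (set_system nat)) : Prop :=
  [/\ L `<=` betaN0, L !=set0 &
      forall p r, betaN0 p -> L r -> L (uadd p r)].

Definition minimal_left_ideal (L : set (set_system nat)) : Prop :=
  left_ideal L /\ forall L', left_ideal L' -> L' `<=` L -> L' = L.

(* beta N_0 + q *)
Definition betaN0_add (q : set_system nat) : set (set_system nat) :=
  [set uadd r q | r in betaN0].

Definition idempotent_uf (q : set_system nat) : Prop := uadd q q = q.

Definition minimal_uf (q : set_system nat) : Prop :=
  minimal_left_ideal (betaN0_add q).

Section Torus.
Variables (R : realType) (d : nat).

Definition unit_cube : set 'rV[R]_d := [set x | forall i, 0 <= x 0 i < 1].

Definition fracv (y : 'rV[R]_d) : 'rV[R]_d :=
  \row_i (y 0 i - (Num.floor (y 0 i))%:~R).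

Definition orbit_pt (k : nat) (x0 : 'rV[R]_d) (n : nat) : 'rV[R]_d :=
  fracv ((k ^ n)%:R *: x0).

Definition basic_semialgebraic (eqs pos : seq {mpoly R[d]}) : set 'rV[R]_d :=
  [set x | (forall f, f \in eqs -> f.@[x 0] = 0) /\
           (forall g, g \in pos -> 0 < g.@[x 0])].

Definition semialgebraic (S : set 'rV[R]_d) : Prop :=
  exists s : seq (seq {mpoly R[d]} * seq {mpoly R[d]}),
    S = [set x | exists2 c, c \in s & basic_semialgebraic c.1 c.2 x].

End Torus.

(* Sequences in N are sequences of positive natural numbers. *)
Definition IP_set (A : set nat) : Prop :=
  exists u : nat -> nat, (forall i, (0 < u i)%N) /\
    forall F : {fset nat}, F != fset0 -> A (\sum_(i <- F) u i)%N.

Definition IP_star (A : set nat) : Prop :=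
  forall B, IP_set B -> A `&` B !=set0.

(* Translates may go in either direction: they are the sets (A + a) `&` N_0
   with a an integer. *)
Definition IP_star_plus (A : set nat) : Prop :=
  exists a : int,
    IP_star [set n : nat | exists2 m : nat, A m & n%:Z = m%:Z + a].

(* Main.v *)
Require Import Defs.
From mathcomp Require Import all_boot all_order all_algebra finmap mpoly ring lra.
From mathcomp Require Import boolp classical_sets filter reals.

Import Order.TTheory GRing.Theory Num.Theory.
Local Open Scope classical_set_scope.
Local Open Scope ring_scope.

Set Implicit Arguments.
Unset Strict Implicit.
Unset Printing Implicit Defensive.

(** Let [y] be the [q]-limit of [x^m] in R^d and [eps m = x^m - y]. For each [n]
    and [q]-almost all [m] one has [x^(n+m) = w n + k^n eps m] with [w n] congruent
    to [k^n y] modulo Z^d, and [w (n+m) = w n + k^n e m] with [e m = w m - y]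
    tending to 0 along [q]. For a polynomial [f], the sign of [f (a + t eps m)] for
    [q]-almost all [m] is the sign of the first nonvanishing term in a finite list
    of real polynomials in [(a, t)]. Since [p + q = p], at [(a, t) = (w n, k^n)] the
    top coefficients in [t] decide, for [p]-almost all [n]; they still decide, with
    the same result, at [(w n + c, k^n + h)] for [c] small and [h] large, provided
    the coefficients vanishing at [w n] also vanish at [w n + c]. A polynomial
    vanishing at [w (n+m) = w n + k^n e m] for [q]-almost all [m] vanishes on
    [w n + K] for a linear space [K] containing [q]-almost all [e m], and small
    vectors [c] congruent to [h y] lie in [K] because the span of the [e m] is
    rational. Every IP set contains large [h] for which [h y] is congruent to a
    small [c], and [w n + c + (k^n + h) eps m] is then the representative of
    [(k^n + h) x^m] in the unit cube; so translating by [-k^n] gives an IP* set. *)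

(** * Limits along filters *)

Lemma ultra_near (q : set_system nat) (P : nat -> Prop) : UltraFilter q ->
  (\forall m \near q, P m) \/ (\forall m \near q, ~ P m).
Proof. exact: in_ultra_setVsetC. Qed.

Lemma near_all_in (T : Type) (F : set_system T) (I : eqType) (s : seq I)
    (P : I -> T -> Prop) : Filter F ->
  (forall i, i \in s -> \forall x \near F, P i x) ->
  \forall x \near F, forall i, i \in s -> P i x.
Proof.
move=> FF; elim: s => [|a s IH] H; first by near=> x.
have Ha := H a (mem_head _ _).
have {}IH : \forall x \near F, forall i, i \in s -> P i x.
  by apply: IH => i si; apply: H; rewrite inE si orbT.
near=> x => i; rewrite inE => /predU1P[->|]; first by near: x.
by move: i; near: x.
Unshelve. all: by end_near. Qed.

Lemma ultra_near_ex (q : set_system nat) (I : finType) (P : I -> nat -> Prop) :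
  UltraFilter q -> (\forall m \near q, exists i, P i m) ->
  exists i, \forall m \near q, P i m.
Proof.
move=> qU qP; apply: contrapT => /forallNP nP.
have : \forall m \near q, forall i, ~ P i m.
  by apply: filter_forall => i; case: (ultra_near (P i) qU) => // /nP.
move=> H; apply: (@filter_not_empty _ q _).
by apply: filterS2 qP H => m [i Pi] /(_ i).
Qed.

Section FilterLimit.
Context {R : realType} {T : Type}.
Implicit Types (F : set_system T) (u v : T -> R).

Definition flim F u (l : R) : Prop :=
  forall e, 0 < e -> \forall x \near F, `|u x - l| < e.

Lemma flim_cst F l : Filter F -> flim F (fun=> l) l.
Proof. by move=> FF e e0; near=> x; rewrite subrr normr0. Unshelve. all: by end_near. Qed.

Lemma flim_near F u v l : Filter F -> (\forall x \near F, u x = v x) ->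
  flim F u l -> flim F v l.
Proof. by move=> FF uv ul e /ul; apply: filterS2 uv => x ->. Qed.

Lemma flimD F u v l l' : Filter F -> flim F u l -> flim F v l' ->
  flim F (fun x => u x + v x) (l + l').
Proof.
move=> FF ul vl e e0; have e2 : 0 < e / 2 by rewrite divr_gt0.
apply: filterS2 (ul _ e2) (vl _ e2) => x ux vx.
have := ler_normD (u x - l) (v x - l'); rewrite addrACA -opprD.
lra.
Qed.

Lemma flimM F u v l l' : Filter F -> flim F u l -> flim F v l' ->
  flim F (fun x => u x * v x) (l * l').
Proof.
move=> FF ul vl e e0.
(* The error is at most [d * d + |l| * d + d * |l'|], and [d <= 1] bounds this by [d * M]. *)
pose M := 1 + `|l| + `|l'|; have M0 : 0 < M by rewrite /M; have := normr_ge0 l; have := normr_ge0 l'; lra.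
pose d := Num.min 1 (e / M).
have d0 : 0 < d by rewrite lt_min ltr01 divr_gt0.
have dM : d * M <= e by rewrite -ler_pdivlMr // ge_min lexx orbT.
have d1 : d <= 1 by rewrite ge_min lexx.
apply: filterS2 (ul _ d0) (vl _ d0) => x ux vx.
have -> : u x * v x - l * l' =
    (u x - l) * (v x - l') + (l * (v x - l') + (u x - l) * l') by ring.
apply: le_lt_trans (ler_normD _ _) _.
apply: le_lt_trans (lerD (lexx _) (ler_normD _ _)) _.
rewrite !normrM; apply: lt_le_trans dM; rewrite /M !mulrDr mulr1 -addrA.
apply: ltr_leD.
  have [->|n0] := eqVneq (u x - l) 0; first by rewrite normr0 mul0r.
  apply: lt_le_trans (_ : `|u x - l| * d <= _); first by rewrite ltr_pM2l ?normr_gt0.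
  by rewrite -[leRHS]mul1r ler_pM2r // (le_trans (ltW ux)).
by rewrite mulrC; apply: lerD; apply: ler_wpM2r => //; apply: ltW.
Qed.

Lemma flim_sum F (I : Type) (s : seq I) (u : I -> T -> R) (l : I -> R) :
  Filter F -> (forall i, flim F (u i) (l i)) ->
  flim F (fun x => \sum_(i <- s) u i x) (\sum_(i <- s) l i).
Proof.
move=> FF H; elim: s => [|i s IH].
  apply: flim_near (flim_cst _ FF); near=> x; by rewrite !big_nil.
rewrite big_cons; apply: flim_near (flimD FF (H i) IH).
by near=> x; rewrite big_cons.
Unshelve. all: by end_near. Qed.

Lemma flim_uniq F u l l' : ProperFilter F -> flim F u l -> flim F u l' -> l = l'.
Proof.
move=> FF ul ul'; apply/eqP; rewrite -subr_eq0 -normr_eq0; apply: contrapT => /negP h.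
have e0 : 0 < `|l - l'| / 2 by rewrite divr_gt0 // lt_def normr_ge0 h.
near F => x.
have := ler_normB (u x - l') (u x - l).
have -> : u x - l' - (u x - l) = l - l' by ring.
have : `|u x - l| < `|l - l'| / 2 by near: x; apply: ul.
have : `|u x - l'| < `|l - l'| / 2 by near: x; apply: ul'.
lra.
Unshelve. all: by end_near. Qed.

Lemma flim_sgr F {FF : Filter F} u l : flim F u l -> l != 0 ->
  \forall x \near F, Num.sg (u x) = Num.sg l.
Proof.
move=> ul l0; have := ul `|l|; rewrite normr_gt0 => /(_ l0).
apply: filterS => x; case: (ltrgt0P l) l0 => //= hl _.
  by rewrite ltr_norml => /andP[h1 h2]; rewrite !gtr0_sg //; lra.
by rewrite ltr_norml => /andP[h1 h2]; rewrite !ltr0_sg //; lra.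
Qed.

Lemma flim_int F u l : ProperFilter F -> (forall x, u x \is a Num.int) ->
  flim F u l -> \forall x \near F, u x = l.
Proof.
move=> FF uZ ul.
have h0 : 0 < 1 / 2 :> R by lra.
have [x0 hx0] := filter_ex (ul _ h0).
have ux0 : \forall x \near F, u x = u x0.
  near=> x; apply/eqP; rewrite -subr_eq0 -[_ == 0]negbK; apply/negP => h.
  have := norm_intr_ge1 (rpredB (uZ x) (uZ x0)) h.
  have : `|u x - l| < 1/2 by near: x; apply: ul.
  have := ler_normB (u x - l) (u x0 - l).
  have -> : u x - l - (u x0 - l) = u x - u x0 by ring.
  lra.
suff <- : u x0 = l by [].
apply: flim_uniq ul; apply: flim_near (flim_cst (u x0) _).
by apply: filterS ux0 => x ->.
Unshelve. all: by end_near. Qed.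

End FilterLimit.

Lemma ultra_flim (R : realType) (q : set_system nat) (u : nat -> R) (M : R) :
  UltraFilter q -> (\forall m \near q, `|u m| <= M) -> exists l, flim q u l.
Proof.
move=> qU uM.
(* The limit is the supremum of the lower bounds of [u] along [q]; as [q] is an ultrafilter, [u] is
   almost always below any larger number. *)
pose E := [set t : R | \forall m \near q, t <= u m].
have Esup : has_sup E.
  split; first by exists (- M); apply: filterS uM => m; rewrite ler_norml => /andP[].
  exists M => t Et; near q => m.
  apply: (@le_trans _ _ (u m)); first by near: m.
  by apply: le_trans (ler_norm _) _; near: m.
exists (sup E) => e e0.
have [t Et te] := sup_adherent e0 Esup.
have nE : ~ E (sup E + e / 2).
  by move=> /(ub_le_sup Esup.2); lra.
case: (ultra_near (fun m => sup E + e / 2 <= u m) qU) => // h.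
apply: filterS2 Et h => m h1 /negP; rewrite -ltNge => h2.
by rewrite ltr_norml; apply/andP; split; lra.
Unshelve. all: by end_near. Qed.

(** * Lexicographic signs and polynomials *)

Section LexSign.
Context {R : realType}.

(** The sign of [x_0 + x_1 h + x_2 h^2 + ...] for all sufficiently small [h > 0]. *)
Fixpoint lexsg (s : seq R) : R :=
  if s is x :: s' then if x == 0 then lexsg s' else Num.sg x else 0.

Lemma lexsg_cat s1 s2 :
  lexsg (s1 ++ s2) = if lexsg s1 == 0 then lexsg s2 else lexsg s1.
Proof.
elim: s1 => [|x s IH] /=; first by rewrite eqxx.
by case: ifP => // x0; rewrite sgr_eq0 x0.
Qed.

Lemma lexsg_eq0 s : lexsg s = 0 -> forall x, x \in s -> x = 0.
Proof.
elim: s => [|y s IH] //=; case: eqVneq => [-> /IH h x|y0 /eqP].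
  by rewrite inE => /predU1P[|/h].
by rewrite sgr_eq0 (negbTE y0).
Qed.

(* Along an ultrafilter a sequence in R^N approaches a flag: writing it as a
   sum of terms of decreasing order of magnitude in the directions [vs], every
   linear form takes the sign of its first nonzero value on [vs]. *)
Lemma ultra_flag (q : set_system nat) N (E : nat -> 'I_N -> R) : UltraFilter q ->
  exists vs : seq ('I_N -> R), forall A : 'I_N -> R, \forall m \near q,
    Num.sg (\sum_j A j * E m j) = lexsg [seq \sum_j A j * v j | v : 'I_N -> R <- vs].
Proof.
(* Induction on the size of a set [D] outside which every coordinate vanishes almost always. *)
move=> qU; have : exists D : {set 'I_N}, forall j, j \notin D -> \forall m \near q, E m j = 0.
  by exists [set: 'I_N]%SET => j; rewrite finset.in_setT.
case=> D; move: {2}#|D| (leqnn #|D|) => n; elim: n => [|n IH] in D E *.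
  rewrite leqn0 cards_eq0 => /eqP -> E0; exists [::] => A.
  have {}E0 : \forall m \near q, forall j, E m j = 0.
    by apply: filter_forall => j; apply: E0; rewrite inE.
  by apply: filterS E0 => m h; rewrite big1 ?sgr0 // => j _; rewrite h mulr0.
move=> leDn ED.
have [E0|nE0] := ultra_near (fun m => forall j, E m j = 0) qU.
  exists [::] => A; apply: filterS E0 => m h; rewrite big1 ?sgr0 // => j _.
  by rewrite h mulr0.
(* A coordinate of maximal modulus; as there are finitely many, one [i] serves almost all [m]. The
   ratios to it are bounded by 1, so they converge. *)
have [i Ei] : exists i, \forall m \near q,
    E m i != 0 /\ forall j, `|E m j| <= `|E m i|.
  apply: ultra_near_ex; apply: filterS nE0 => m /existsNP[j /eqP Emj].
  case: (@arg_maxP _ _ _ j xpredT (fun i => `|E m i|)) => // i _ iM.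
  exists i; split; last by move=> l; exact: iM.
  by rewrite -normr_gt0; apply: lt_le_trans (iM j isT); rewrite normr_gt0.
have [s s0 Es] : exists2 s : R, s != 0 & \forall m \near q, Num.sg (E m i) = s.
  have [Ep|En] := ultra_near (fun m => 0 < E m i) qU.
    by exists 1; [exact: oner_neq0|apply: filterS Ep => m /gtr0_sg].
  exists (-1); first by rewrite oppr_eq0 oner_neq0.
  apply: filterS2 Ei En => m [Emi _] /negP; rewrite -leNgt => h.
  by apply: ltr0_sg; rewrite lt_def eq_sym Emi.
have iD : i \in D.
  apply: contrapT => /negP /ED h; have [m [[/eqP]]] := filter_ex (filterI Ei h).
  by [].
have /choice[v vE] : forall j, exists l, flim q (fun m => E m j / E m i) l.
  move=> j; apply: (ultra_flim (M := 1)).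
  apply: filterS Ei => m [Emi h].
  by rewrite normrM normfV ler_pdivrMr ?normr_gt0 // mul1r.
have vi : v i = 1.
  apply: flim_uniq (vE i) _; apply: flim_near (flim_cst 1 _).
  by apply: filterS Ei => m [Emi _]; rewrite divff.
have vD j : j \notin D -> v j = 0.
  move=> jD; apply: flim_uniq (vE j) _; apply: flim_near (flim_cst 0 _).
  by apply: filterS (ED j jD) => m ->; rewrite mul0r.
(* Subtracting the leading term [E m i * v] kills coordinate [i], since [v i = 1], and so shrinks
   [D]. A form vanishing at [v] does not see the subtracted term. *)
have [] := IH (D :\ i)%SET (fun m j => E m j - E m i * v j).
- by rewrite -ltnS (leq_trans _ leDn) // [in leqRHS](cardsD1 i) iD.
- move=> j; rewrite !inE negb_and negbK => /predU1P[->|jD].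
    by near=> m; rewrite vi mulr1 subrr.
  by apply: filterS (ED j jD) => m ->; rewrite vD // mulr0 subrr.
move=> vs Hvs; exists ((fun j => s * v j) :: vs) => A /=.
have -> : \sum_j A j * (s * v j) = s * \sum_j A j * v j.
  by rewrite mulr_sumr; apply: eq_bigr => j _; rewrite mulrCA.
rewrite mulf_eq0 (negbTE s0) /=; case: eqVneq => [Av0|Av0].
  apply: filterS (Hvs A) => m <-; congr Num.sg.
  have -> : \sum_j A j * (E m j - E m i * v j) =
      \sum_j A j * E m j - E m i * \sum_j A j * v j.
    by rewrite mulr_sumr -sumrB; apply: eq_bigr => j _; ring.
  by rewrite Av0 mulr0 subr0.
have Alim : flim q (fun m => \sum_j A j * (E m j / E m i)) (\sum_j A j * v j).
  by apply: flim_sum => j; apply: flimM (vE j); apply: flim_cst.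
have {}Alim : \forall m \near q, Num.sg (\sum_j A j * (E m j / E m i)) =
    Num.sg (\sum_j A j * v j) by exact: flim_sgr.
apply: filterS3 Ei Es Alim => m [Emi _] <-; rewrite sgrM sgr_id => <-.
rewrite -sgrM mulr_sumr; congr Num.sg; apply: eq_bigr => j _.
by rewrite mulrCA; congr (_ * _); rewrite mulrCA divff // mulr1.
Unshelve. all: by end_near. Qed.

End LexSign.

(** Rows of maximal rank are chosen in [P]: adjoining another vector of [P] cannot raise the
    rank. *)
Lemma finite_span (F : fieldType) n (P : set 'rV[F]_n) :
  exists r (B : 'M[F]_(r, n)),
    (forall i, P (row i B)) /\ forall v, P v -> (v <= B)%MS.
Proof.
pose Q k := `[< exists r (B : 'M[F]_(r, n)), (forall i, P (row i B)) /\ \rank B = k >].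
have Q0 : exists k, Q k.
  by exists 0%N; apply/asboolP; exists 0%N, 0; split=> [[]|] //; rewrite mxrank0.
have Qn k : Q k -> (k <= n)%N.
  by move=> /asboolP[r [B [_ <-]]]; exact: rank_leq_col.
have [k /asboolP[r [B [PB rB]]] kmax] := ex_maxnP Q0 Qn.
exists r, B; split=> // v Pv.
have sB : (B <= col_mx B v)%MS by rewrite -addsmxE addsmxSl.
suff : (col_mx B v <= B)%MS by apply: submx_trans; rewrite -addsmxE addsmxSr.
rewrite -(mxrank_leqif_sup sB) eqn_leq (mxrankS sB) rB /=; apply: kmax.
apply/asboolP; exists (r + 1)%N, (col_mx B v); split=> // i.
by case: (split_ordP i) => j ->; rewrite ?rowKu ?rowKd ?row_id // [j]ord1 row_id.
Qed.

Lemma mpoly_ring_ind (R : comNzRingType) n (P : {mpoly R[n]} -> Prop) :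
  (forall c, P c%:MP) -> (forall i, P 'X_i) ->
  (forall f g, P f -> P g -> P (f + g)) -> (forall f g, P f -> P g -> P (f * g)) ->
  forall f, P f.
Proof.
move=> PC PX PD PM f; rewrite [f]mpolyE; apply: (big_ind P) => //.
  by rewrite -mpolyC0.
move=> m _; rewrite -mul_mpolyC; apply: (PM) => //; rewrite mpolyXE_id.
apply: (big_ind P) => [|g h|i _]; [by rewrite -mpolyC1|exact: PM|].
elim: (m i) => [|e IH]; first by rewrite expr0 -mpolyC1.
by rewrite exprS; apply: PM.
Qed.

Notation ev f a := (f%R.@[(a : 'rV_ _) ord0]).

Section Meval.
Context {R : realType} {d : nat}.
Implicit Types (f : {mpoly R[d]}).

Lemma flim_meval T (F : set_system T) (a : T -> 'rV[R]_d) (a0 : 'rV[R]_d) f :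
  Filter F -> (forall i, flim F (fun x => a x 0 i) (a0 0 i)) ->
  flim F (fun x => ev f (a x)) (ev f a0).
Proof.
move=> FF aa0; elim/mpoly_ring_ind: f => [c|i|f g IHf IHg|f g IHf IHg].
- rewrite mevalC; apply: flim_near (flim_cst c FF).
  by near=> x; rewrite mevalC.
- rewrite mevalXU; apply: flim_near (aa0 i).
  by near=> x; rewrite mevalXU.
- rewrite mevalD; apply: flim_near (flimD FF IHf IHg).
  by near=> x; rewrite mevalD.
- rewrite mevalM; apply: flim_near (flimM FF IHf IHg).
  by near=> x; rewrite mevalM.
Unshelve. all: by end_near. Qed.

(** Separation of variables: along [x = eps m] the polynomial becomes a linear form in the vector
    [psi j (eps m)], with coefficients depending only on [a] and [t]. *)
Lemma meval_line f : exists N (b : 'I_N -> {mpoly R[d]}) (i : 'I_N -> nat)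
    (psi : 'I_N -> 'rV[R]_d -> R),
  forall a t x, ev f (a + t *: x) = \sum_j ev (b j) a * t ^+ i j * psi j x.
Proof.
suff [s Hs] : exists s : seq ({mpoly R[d]} * nat * ('rV[R]_d -> R)), forall a t x,
    ev f (a + t *: x) = \sum_(c <- s) ev c.1.1 a * t ^+ c.1.2 * c.2 x.
  pose c0 : {mpoly R[d]} * nat * ('rV[R]_d -> R) := (0, 0%N, fun=> 0).
  exists (size s), (fun j => (nth c0 s j).1.1), (fun j => (nth c0 s j).1.2),
    (fun j => (nth c0 s j).2) => a t x.
  by rewrite Hs (big_nth c0) big_mkord.
elim/mpoly_ring_ind: f => [c|i|f g [s Hs] [s' Hs']|f g [s Hs] [s' Hs']].
- exists [:: (c%:MP, 0%N, fun=> 1)] => a t x.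
  by rewrite big_seq1 /= !mevalC expr0 !mulr1.
- exists [:: ('X_i, 0%N, fun=> 1); (1, 1%N, fun x : 'rV[R]_d => x 0 i)] => a t x.
  rewrite big_cons big_seq1 /= !mevalXU meval1 !mxE; ring.
- exists (s ++ s') => a t x; by rewrite mevalD Hs Hs' big_cat.
exists [seq (c.1.1 * c'.1.1, (c.1.2 + c'.1.2)%N, fun x => c.2 x * c'.2 x) |
         c <- s, c' <- s'] => a t x.
rewrite mevalM Hs Hs' big_allpairs_dep /= mulr_suml; apply: eq_bigr => c _.
rewrite mulr_sumr; apply: eq_bigr => c' _.
by rewrite mevalM exprD; ring.
Qed.

End Meval.

(** * Signs along the orbit *)

Section PolyInfinity.
Context {R : realType} {d : nat}.
Implicit Types (c : nat -> {mpoly R[d]}) (a : 'rV[R]_d) (t : R).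

Definition polyt n c a t : R := \sum_(i < n) ev (c i) a * t ^+ i.

Fixpoint leadlist n c : seq {mpoly R[d]} :=
  if n is n'.+1 then c n' :: leadlist n' c else [::].

(** On [leadlist n c], which starts at the top degree, this is the sign of [polyt n c a t] for all
    large [t]. *)
Definition lexat (Bs : seq {mpoly R[d]}) a : R := lexsg [seq ev B a | B <- Bs].

Lemma lexat_cons B Bs a :
  lexat (B :: Bs) a = if ev B a == 0 then lexat Bs a else Num.sg (ev B a).
Proof. by []. Qed.

Lemma polytS n c a t : polyt n.+1 c a t = polyt n c a t + ev (c n) a * t ^+ n.
Proof. by rewrite /polyt big_ord_recr. Qed.

(** After division by [t^n] the terms of lower degree tend to 0, since their coefficients converge
    and [1/t] tends to 0. *)
Lemma lead_sgr T (F : set_system T) (a : T -> 'rV[R]_d) (t : T -> R) a0 n c :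
  Filter F -> (forall i, flim F (fun x => a x 0 i) (a0 0 i)) ->
  (forall M, \forall x \near F, M < t x) -> ev (c n) a0 != 0 ->
  \forall x \near F, Num.sg (polyt n.+1 c (a x) (t x)) = Num.sg (ev (c n) a0).
Proof.
move=> FF aa0 too cn0.
have tinv : flim F (fun x => (t x)^-1) 0.
  move=> e e0; near=> x.
  have et : e^-1 < t x by near: x.
  have t0 : 0 < t x by apply: lt_trans et; rewrite invr_gt0.
  by rewrite subr0 gtr0_norm ?invr_gt0 // -[e]invrK ltf_pV2 // posrE invr_gt0.
have low l : flim F (fun x => polyt l c (a x) (t x) / t x ^+ l) 0.
  elim: l => [|l IH].
    by apply: flim_near (flim_cst 0 FF); near=> x; rewrite /polyt big_ord0 mul0r.
  have := flimM FF (flimD FF IH (flim_meval (c l) FF aa0)) tinv.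
  rewrite mulr0; apply: flim_near; near=> x.
  have t0 : 0 < t x by near: x.
  by rewrite polytS exprS; field; rewrite (lt0r_neq0 t0) ?expf_neq0 ?lt0r_neq0.
have := flimD FF (low n) (flim_meval (c n) FF aa0); rewrite add0r => lim.
apply: filterS2 (too 0) (flim_sgr lim cn0) => x t0 <-.
have tn0 : 0 < t x ^+ n by rewrite exprn_gt0.
rewrite polytS -[LHS]mulr1 -(gtr0_sg (_ : 0 < (t x ^+ n)^-1)) ?invr_gt0 //.
by rewrite -sgrM mulrDl mulfK // lt0r_neq0.
Unshelve. all: by end_near. Qed.

(** The product of the neighbourhood filter of [a0] with that of +infinity. *)
Definition near_infty a0 : set_system ('rV[R]_d * R) :=
  [set P | exists delta M, 0 < delta /\ forall a t,
     (forall i, `|a 0 i - a0 0 i| < delta) -> M < t -> P (a, t)].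

Lemma near_infty_filter a0 : Filter (near_infty a0).
Proof.
split.
- by exists 1, 0.
- move=> P Q [e [M [e0 PM]]] [e' [M' [e'0 QM']]].
  exists (Num.min e e'), (Num.max M M'); split; first by rewrite lt_min e0.
  move=> a t ha; rewrite gt_max => /andP[Mt M't]; split.
    by apply: PM => // i; apply: lt_le_trans (ha i) _; rewrite ge_min lexx.
  by apply: QM' => // i; apply: lt_le_trans (ha i) _; rewrite ge_min lexx orbT.
- by move=> P Q PQ [e [M [e0 PM]]]; exists e, M; split=> // a t ha /PM; auto.
Qed.

(** A polynomial vanishing at [a0] may take either sign nearby; this condition removes the
    ambiguity. *)
Definition zeros_persist (Bs : seq {mpoly R[d]}) a0 a :=
  forall B, B \in Bs -> ev B a0 = 0 -> ev B a = 0.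

(** From the top degree down, a coefficient vanishing at [a0] drops out by [zeros_persist]; the
    first other one decides by [lead_sgr]. *)
Lemma sgr_near_infty n c a0 : \forall z \near near_infty a0,
  zeros_persist (leadlist n c) a0 z.1 ->
  Num.sg (polyt n c z.1 z.2) = lexat (leadlist n c) a0.
Proof.
have FF := near_infty_filter a0.
elim: n => [|n IH]; first by near=> z; rewrite /polyt big_ord0 sgr0.
rewrite /= lexat_cons; case: eqVneq => [c0|c0].
  apply: filterS IH => z IH zp; rewrite polytS zp ?mem_head // mul0r addr0 IH //.
  by move=> B BBs; apply: zp; rewrite inE BBs orbT.
have := @lead_sgr _ _ (fun z => z.1) (fun z => z.2) a0 n c FF _ _ c0.
move=> H; apply: filterS (H _ _).
- by move=> z ->.
- by move=> i e e0; exists e, 0; split => // a t.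
- by move=> M; exists 1, M.
Unshelve. all: by end_near. Qed.

Lemma polyt_line N (b : 'I_N -> {mpoly R[d]}) (i : 'I_N -> nat) (v : 'I_N -> R) :
  exists n c, forall a t, \sum_j ev (b j) a * t ^+ i j * v j = polyt n c a t.
Proof.
exists (\max_j i j).+1, (fun l => \sum_(j | i j == l) v j *: b j) => a t.
transitivity (\sum_(l < (\max_j i j).+1) \sum_(j | i j == l)
    v j * ev (b j) a * t ^+ l); last first.
  apply: eq_bigr => l _; rewrite raddf_sum mulr_suml.
  by apply: eq_bigr => j _; congr (_ * _); rewrite -mevalZ.
rewrite [RHS](exchange_big_dep xpredT) //=; apply: eq_bigr => j _.
have ij : (i j < (\max_j i j).+1)%N by rewrite ltnS (leq_bigmax j).
rewrite (big_pred1 (Ordinal ij)) /=; last by move=> l; rewrite eq_sym.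
by rewrite mulrC mulrA.
Qed.

End PolyInfinity.

Section Recurrence.
Context {R : realType} {d k : nat} {q : set_system nat}.
Hypotheses (k_gt1 : (1 < k)%N) (qU : UltraFilter q) (q_idem : uadd q q = q).
Hypothesis q_infty : forall n, \forall m \near q, (n < m)%N.
Variable e : nat -> 'rV[R]_d.
Hypothesis e_lim : forall i, flim q (fun m => e m 0 i) 0.

(** An identity in R^d rather than modulo Z^d, so that polynomials can be evaluated on it. *)
Definition shift_orbit (w : nat -> 'rV[R]_d) :=
  forall n, \forall m \near q, w (n + m)%N = w n + (k ^ n)%:R *: e m.

Lemma uadd_near p (P : nat -> Prop) : uadd p q = p ->
  (\forall n \near p, P n) = (\forall n \near p, \forall m \near q, P (n + m)%N).
Proof. by move=> pq; rewrite -{1}pq. Qed.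

Lemma shift_orbit_lim w n i : shift_orbit w ->
  flim q (fun m => w (n + m)%N 0 i) (w n 0 i).
Proof.
move=> ww; have FF : Filter q by typeclasses eauto.
have := flimD FF (flim_cst (w n 0 i) FF) (flimM FF (flim_cst (k ^ n)%:R FF) (e_lim i)).
rewrite mulr0 addr0; apply: flim_near; apply: filterS (ww n) => m ->.
by rewrite !mxE.
Qed.

Lemma expn_infty n (M : R) : \forall m \near q, M < (k ^ (n + m))%:R.
Proof.
apply: filterS (q_infty (Num.truncn `|M|).+1) => m hm.
apply: le_lt_trans (ler_norm M) _; apply: lt_trans (truncnS_gt _) _.
rewrite ltr_nat; apply: leq_trans hm _.
by rewrite (leq_trans (leq_addl n _)) // ltnW // ltn_expl.
Qed.

Section Decide.
Context {p : set_system nat} {w : nat -> 'rV[R]_d}.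
Hypotheses (pU : UltraFilter p) (pq : uadd p q = p) (ww : shift_orbit w).

(* A vanishing leading coefficient can be dropped; otherwise [p + q = p] lets the
   power of [k] grow along [q] while the base point stays near [w n]. *)
Lemma sgr_shift_orbit N c : \forall n \near p,
  Num.sg (polyt N c (w n) (k ^ n)%:R) = lexat (leadlist N c) (w n).
Proof.
elim: N => [|N IH]; first by near=> n; rewrite /polyt big_ord0 sgr0.
have [c0|c0] := ultra_near (fun n => ev (c N) (w n) = 0) pU.
  apply: filterS2 c0 IH => n c0 IHn.
  by rewrite /= lexat_cons c0 eqxx polytS c0 mul0r addr0.
rewrite uadd_near //; apply: filterS c0 => n /eqP c0.
have FF : Filter q by typeclasses eauto.
have wlim i := @shift_orbit_lim w n i ww.
apply: filterS2 (lead_sgr FF wlim (expn_infty n) c0)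
  (flim_sgr (flim_meval (c N) FF wlim) c0) => m -> cm.
by rewrite /= lexat_cons -sgr_eq0 cm sgr_eq0 (negbTE c0).
Unshelve. all: by end_near. Qed.

(** One list [Bs] serves both along the orbit and near [(a0, +infinity)], so that the signs in the
    two regimes can be compared. *)
Definition decided (H : 'rV[R]_d -> R -> R) Bs :=
  (\forall n \near p, H (w n) (k ^ n)%:R = lexat Bs (w n)) /\
  (forall a0, \forall z \near near_infty a0,
     zeros_persist Bs a0 z.1 -> H z.1 z.2 = lexat Bs a0).

Lemma decided_lexsg (Gs : seq ('rV[R]_d -> R -> R)) :
  (forall i, (i < size Gs)%N ->
     exists Bs, decided (fun a t => Num.sg (nth (fun _ _ => 0) Gs i a t)) Bs) ->
  exists Bs, decided (fun a t => lexsg [seq G a t | G : 'rV[R]_d -> R -> R <- Gs]) Bs.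
Proof.
have lexsg_sg x (s s1 s2 : seq R) : Num.sg x = lexsg s1 -> lexsg s = lexsg s2 ->
    lexsg (x :: s) = lexsg (s1 ++ s2).
  by move=> xs1 ss2; rewrite lexsg_cat /= -xs1 sgr_eq0 ss2.
elim: Gs => [|G Gs IH] HG.
  exists [::]; split=> [|a0]; first by near=> n.
  by have FF := near_infty_filter a0; near=> z.
have [Bs1 [p1 z1]] := HG 0%N isT.
have [Bs2 [p2 z2]] := IH (fun i hi => HG i.+1 hi).
exists (Bs1 ++ Bs2); split=> [|a0].
  by apply: filterS2 p1 p2 => n h1 h2; rewrite /lexat map_cat; apply: lexsg_sg.
have FF := near_infty_filter a0.
apply: filterS2 (z1 a0) (z2 a0) => z h1 h2 zp; rewrite /lexat map_cat.
apply: lexsg_sg; [apply: h1|apply: h2] => B BBs; apply: zp; rewrite mem_cat BBs //.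
by rewrite orbT.
Unshelve. all: by end_near. Qed.

(** [meval_line] and [ultra_flag] turn the sign of [f] into the first nonzero sign among finitely
    many polynomials in [(a, t)], each decided by its coefficients in [t]. *)
Lemma sign_transfer (f : {mpoly R[d]}) (eps : nat -> 'rV[R]_d) : exists Bs,
  (\forall n \near p, \forall m \near q,
     Num.sg (ev f (w n + (k ^ n)%:R *: eps m)) = lexat Bs (w n)) /\
  (forall a0, \forall z \near near_infty a0, zeros_persist Bs a0 z.1 ->
     \forall m \near q, Num.sg (ev f (z.1 + z.2 *: eps m)) = lexat Bs a0).
Proof.
have [N [b [i [psi fE]]]] := meval_line f.
have [vs vsE] := ultra_flag (fun m j => psi j (eps m)) qU.
pose G (v : 'I_N -> R) a t := \sum_j ev (b j) a * t ^+ i j * v j.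
have [|Bs [h1 h2]] := @decided_lexsg [seq G v | v <- vs].
  move=> l; rewrite size_map => hl.
  have [n [c Gc]] := polyt_line b i (nth (fun=> 0) vs l).
  exists (leadlist n c); rewrite (nth_map (fun=> 0)) // /G; split=> [|a0].
    by apply: filterS (sgr_shift_orbit n c) => m <-; rewrite Gc.
  have FF := near_infty_filter a0.
  by apply: filterS (sgr_near_infty n c a0) => z h /h <-; rewrite Gc.
have sgf a t : \forall m \near q,
    Num.sg (ev f (a + t *: eps m)) = lexsg [seq G a t | G <- [seq G v | v <- vs]].
  apply: filterS (vsE (fun j => ev (b j) a * t ^+ i j)) => m.
  by rewrite -map_comp fE => ->.
exists Bs; split=> [|a0].
  by apply: filterS h1 => n <-; exact: sgf.
have FF := near_infty_filter a0.
by apply: filterS (h2 a0) => z h /h <-; exact: sgf.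
Qed.

End Decide.
End Recurrence.

(** * Persistence of zeros *)

Definition linear_set (R : pzRingType) (V : lmodType R) (K : V -> Prop) : Prop :=
  [/\ K 0, forall u v, K u -> K v -> K (u + v) & forall t v, K v -> K (t *: v)].

Definition intvec (R : realType) d (v : 'rV[R]_d) : Prop :=
  forall i, v 0 i \is a Num.int.

Lemma linear_set_mulmx (R : fieldType) r d (B : 'M[R]_(r, d)) (K : 'rV[R]_d -> Prop) v :
  linear_set K -> (forall i, K (row i B)) -> (v <= B)%MS -> K v.
Proof.
move=> [K0 KD KZ] KB /submxP[u ->]; rewrite mulmx_sum_row.
by apply: (big_ind K) => // i _; apply: KZ.
Qed.

Lemma rat_clear_denominators (R : archiNumFieldType) m n (C : 'M[rat]_(m, n)) :
  exists2 D : nat, (0 < D)%N &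
    forall i j, D%:R * (ratr (C i j) : R) \is a Num.int.
Proof.
exists (\prod_(x : 'I_m * 'I_n) `|denq (C x.1 x.2)|)%N.
  by rewrite prodn_gt0 // => x; rewrite absz_gt0 denq_neq0.
move=> i j; rewrite (bigD1 (i, j)) //= natrM mulrAC rpredM ?natr_int //.
rewrite natr_absz ger0_norm ?denq_ge0 // /ratr mulrC divfK ?intr_int //.
by rewrite intr_eq0 denq_neq0.
Qed.

Section Hull.
Context {R : realType} {d k : nat} {q : set_system nat}.
Hypotheses (k_gt1 : (1 < k)%N) (qU : UltraFilter q) (q_idem : uadd q q = q).
Hypothesis q_infty : forall n, \forall m \near q, (n < m)%N.
Variable e : nat -> 'rV[R]_d.
Hypothesis e_lim : forall i, flim q (fun m => e m 0 i) 0.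

Lemma polyt_eq0 n (c : nat -> {mpoly R[d]}) a :
  (forall B, B \in leadlist n c -> ev B a = 0) -> forall t, polyt n c a t = 0.
Proof.
elim: n => [|n IH] h t; first by rewrite /polyt big_ord0.
rewrite polytS IH ?h ?mem_head ?mul0r ?addr0 // => B Bs.
by apply: h; rewrite inE Bs orbT.
Qed.

(** [sgr_shift_orbit] with [p = q] reads the sign off the coefficients at [w m]; sign 0 leaves none
    of them nonzero. *)
Lemma polyt_vanish w N (c : nat -> {mpoly R[d]}) : shift_orbit (q := q) (k := k) e w ->
  (\forall m \near q, polyt N c (w m) (k ^ m)%:R = 0) ->
  \forall m \near q, forall t, polyt N c (w m) t = 0.
Proof.
move=> ww H.
apply: filterS2 H (sgr_shift_orbit k_gt1 qU q_infty e_lim qU q_idem ww N c).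
move=> m ->; rewrite sgr0 => /esym/lexsg_eq0 h; apply: polyt_eq0 => B Bs.
by apply: h; apply/mapP; exists B.
Qed.

(* If [b] vanishes at [e m + u] for q-many [m], so does it at
   [e m + u + k^m e m'] by idempotency. As a function of [m'] this lies in a
   finite-dimensional space, so a single set of [m'] works for all [m]; and being
   a polynomial in [k^m] it vanishes identically in that variable. *)
Lemma vanishing_directions (b : {mpoly R[d]}) : shift_orbit (q := q) (k := k) e e ->
  exists K, [/\ linear_set K, \forall m \near q, K (e m) &
    forall u v, K v -> (\forall m \near q, ev b (e m + u) = 0) -> ev b (u + v) = 0].
Proof.
move=> ee.
have [N [bb [ii [psi bE]]]] := meval_line b.
pose E m := \col_(j < N) psi j (e m).
(* Finitely many of the linear relations valid for almost all [m] generate the others, so all hold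
   together on one set of [q]. *)
have [r [B [PB BP]]] := finite_span [set A : 'rV[R]_N | \forall m \near q, A *m E m = 0].
have BE : \forall m \near q, B *m E m = 0.
  have : \forall m \near q, forall i, row i B *m E m = 0 by apply: filter_forall.
  by apply: filterS => m h; apply/row_matrixP => i; rewrite row_mul h row0.
(* Quantifying over all [u] makes [K] closed under sums: the second direction is followed from the
   base point [u + t *: v]. *)
pose K v := forall u, (\forall m \near q, ev b (e m + u) = 0) ->
  forall t, \forall m \near q, ev b (e m + u + t *: v) = 0.
exists K; split.
- split.
  + by move=> u hu t; apply: filterS hu => m; rewrite scaler0 addr0.
  + move=> v v' Kv Kv' u hu t.
    have h : \forall m \near q, ev b (e m + (u + t *: v)) = 0.
      by apply: filterS (Kv u hu t) => m; rewrite addrA.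
    by apply: filterS (Kv' _ h t) => m; rewrite scalerDr !addrA.
  + by move=> s v Kv u hu t; apply: filterS (Kv u hu (t * s)) => m; rewrite scalerA.
- apply: filterS BE => m' Bm' u hu.
  have [n [c cE]] := polyt_line bb ii (fun j => psi j (e m')).
  have ww : shift_orbit (q := q) (k := k) e (fun m => e m + u).
    by move=> m; apply: filterS (ee m) => l ->; rewrite addrAC.
  suff H : \forall m \near q, polyt n c (e m + u) (k ^ m)%:R = 0.
    by move=> t; apply: filterS (polyt_vanish ww H) => m h; rewrite bE cE h.
  move: hu; rewrite (uadd_near _ q_idem); apply: filterS => m hm.
  pose A := \row_j (ev (bb j) (e m + u) * (k ^ m)%:R ^+ ii j).
  have AE l : (A *m E l) 0 0 = ev b (e m + u + (k ^ m)%:R *: e l).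
    by rewrite bE mxE; apply: eq_bigr => j _; rewrite !mxE.
  have /BP/submxP[s As] : \forall l \near q, A *m E l = 0.
    apply: filterS2 (ee m) hm => l eml h; apply/matrixP => i j.
    by rewrite !ord1 AE mxE addrAC -eml.
  by rewrite -cE -bE -AE As -mulmxA Bm' mulmx0 mxE.
move=> u v Kv hu.
have lim : flim q (fun m => ev b (e m + u + 1 *: v)) (ev b (u + v)).
  apply: flim_meval => i; have FF : Filter q by typeclasses eauto.
  have := flimD FF (e_lim i) (flim_cst ((u + v) 0 i) FF).
  rewrite add0r; apply: flim_near; near=> m.
  by rewrite scale1r -addrA [in RHS]mxE.
apply: flim_uniq lim _; apply: flim_near (flim_cst 0 _).
by apply: filterS (Kv u hu 1) => m ->.
Unshelve. all: by end_near. Qed.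

(* Modulo the multiples of [y] the [e m] are integer vectors, so
   [(k^m - 1) e m0 - (k^m0 - 1) e m] is one as well. Dividing by [k^m - 1] shows
   that [e m0] is a limit of rational vectors of [K]; hence it is killed by a
   rational matrix whose kernel lies in [K]. *)
Lemma linear_set_discrete (K : 'rV[R]_d -> Prop) (y : 'rV[R]_d) : linear_set K ->
  (\forall m \near q, K (e m)) ->
  (forall m, intvec (e m - ((k ^ m)%:R - 1) *: y)) ->
  exists2 delta, 0 < delta & forall c (h : nat), intvec (c - h%:R *: y) ->
    (forall i, `|c 0 i| < delta) -> K c.
Proof.
move=> Klin Ke ey; have [K0 KD KZ] := Klin.
have FF : Filter q by typeclasses eauto.
(* The rows of [B] span the rational vectors of [K]; [C] is a rational matrix whose kernel is their
   real span. *)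
have [r [B [PB BP]]] := finite_span [set M : 'rV[rat]_d | K (map_mx ratr M)].
pose C := map_mx (ratr : rat -> R) (cokermx B).
have CK v : v *m C = 0 -> K v.
  rewrite /C map_cokermx => /eqP; rewrite -submxE; apply: linear_set_mulmx => // i.
  by rewrite -map_row; apply: PB.
have KC M : intvec M -> K M -> M *m C = 0.
  move=> Mint KM; pose M' : 'rV[rat]_d := \row_i (Num.floor (M 0 i))%:~R.
  have MM' : M = map_mx ratr M'.
    by apply/rowP => i; rewrite !mxE ratr_int; apply/esym/eqP; rewrite -intrEfloor.
  have : (M' <= B)%MS by apply: BP; rewrite /= -MM'.
  by rewrite submxE => /eqP h; rewrite MM' -map_mxM h map_mx0.
have intC D M j : (forall i j, D * C i j \is a Num.int) -> intvec M ->
    D * (M *m C) 0 j \is a Num.int.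
  move=> DC Mint; rewrite mxE mulr_sumr; apply: rpred_sum => i _.
  by rewrite mulrCA; apply: rpredM.
have k1 m : 1 <= (k ^ m)%:R :> R by rewrite ler1n expn_gt0 (ltnW k_gt1).
have kint m : (k ^ m)%:R - 1 \is a @Num.int R by rewrite rpredB ?natr_int ?rpred1.
have eC : \forall m \near q, e m *m C = 0.
  apply: filterS (Ke) => m0 Km0; apply/rowP => j; rewrite [RHS]mxE.
  apply/eqP; rewrite -normr_le0 leNgt; apply/negP => X0.
  have lim0 : flim q (fun m => ((k ^ m0)%:R - 1) * (e m *m C) 0 j) 0.
    rewrite -(mulr0 ((k ^ m0)%:R - 1)); apply: flimM; first exact: flim_cst.
    have := @flim_sum _ _ q _ (index_enum 'I_d) (fun i m => e m 0 i * C i j) (fun=> 0) FF.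
    rewrite big1 // => h; apply: flim_near (h _); first by near=> m; rewrite mxE.
    by move=> i; rewrite -(mul0r (C i j)); apply: flimM; [exact: e_lim|exact: flim_cst].
  (* For fixed [m0], this [m] makes entry [j] of [(k^m0 - 1) e m *m C] smaller than that of
     [e m0 *m C], although it equals the latter times [k^m - 1 >= 1]. *)
  have [m [[/= Km m_gt0] /= Xm]] := filter_ex (filterI (filterI Ke (q_infty 0)) (lim0 _ X0)).
  have Mint : intvec (((k ^ m)%:R - 1) *: e m0 - ((k ^ m0)%:R - 1) *: e m).
    move=> i; rewrite (_ : _ 0 i = ((k ^ m)%:R - 1) * (e m0 - ((k ^ m0)%:R - 1) *: y) 0 i -
      ((k ^ m0)%:R - 1) * (e m - ((k ^ m)%:R - 1) *: y) 0 i).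
      by apply: rpredB; apply: rpredM; rewrite ?kint //; apply: ey.
    by rewrite !mxE; ring.
  have KM : K (((k ^ m)%:R - 1) *: e m0 - ((k ^ m0)%:R - 1) *: e m).
    by apply: KD; [exact: KZ|rewrite -scaleNr; exact: KZ].
  have := KC _ Mint KM; rewrite mulmxBl -!scalemxAl.
  move: (e m0 *m C) (e m *m C) X0 Xm => a b a0 ba /rowP/(_ j).
  rewrite !mxE => /eqP; rewrite subr_eq0 => /eqP ab.
  move: ba; rewrite subr0 -ab normrM ltNge ler_peMl // ger0_norm ?subr_ge0 //.
  by rewrite lerBrDr -(natrD _ 1 1) ler_nat; apply: leq_ltn_trans m_gt0 (ltn_expl _ k_gt1).
have [D D0 DC] := rat_clear_denominators R (cokermx B).
have [m0 [/= em0C m0_gt0]] := filter_ex (filterI eC (q_infty 0)).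
pose A : R := (k ^ m0)%:R - 1.
have A0 : 0 < A by rewrite subr_gt0 ltr1n; apply: leq_ltn_trans m0_gt0 (ltn_expl _ k_gt1).
pose S := \sum_i \sum_j `|C i j|.
have S0 : 0 <= S by rewrite sumr_ge0 // => i _; rewrite sumr_ge0.
have S1 : 0 < 1 + S by apply: ltr_pwDl.
have DA0 : 0 < D%:R * A by rewrite mulr_gt0 // ltr0n.
(* [D * A * (c *m C) 0 j] is an integer, because [e m0 *m C = 0] and [A *: c - h%:R *: e m0] is
   integral; this bound forces its modulus below 1. *)
exists (D%:R * A * (1 + S))^-1; first by rewrite invr_gt0 mulr_gt0.
move=> c h cy csmall; apply: CK; apply/rowP => j; rewrite [RHS]mxE.
have Mint : intvec (A *: c - h%:R *: e m0).
  move=> i; rewrite (_ : _ 0 i = A * (c - h%:R *: y) 0 i - h%:R * (e m0 - A *: y) 0 i).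
    apply: rpredB; apply: rpredM; [exact: kint|exact: cy|exact: natr_int|exact: ey].
  by rewrite !mxE; ring.
have DC' i l : D%:R * C i l \is a Num.int by rewrite mxE.
have := intC _ _ j DC' Mint.
rewrite mulmxBl -!scalemxAl em0C scaler0 subr0 mxE mulrA => cint.
apply: contrapT => /eqP cC0.
have nz : D%:R * A * (c *m C) 0 j != 0 by rewrite mulf_neq0 // lt0r_neq0.
have := norm_intr_ge1 cint nz.
apply/negP; rewrite -ltNge normrM gtr0_norm // mulrC -ltr_pdivlMr // div1r.
apply: le_lt_trans (_ : (D%:R * A * (1 + S))^-1 * S < _).
  rewrite mxE; apply: le_trans (ler_norm_sum _ _ _) _.
  rewrite mulr_sumr; apply: ler_sum => i _; rewrite normrM.
  apply: ler_pM => //; first exact: ltW.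
  by rewrite (bigD1 j) //= lerDl sumr_ge0.
rewrite [X in X * S]invfM -mulrA gtr_pMr ?invr_gt0 // mulrC ltr_pdivrMr //; lra.
Unshelve. all: by end_near. Qed.

End Hull.

(** * The orbit on the torus *)

Lemma uaddA (p q r : set_system nat) : uadd (uadd p q) r = uadd p (uadd q r).
Proof.
apply/seteqP; split=> E; rewrite /uadd /=.
  by under eq_set do under eq_set do under eq_set do rewrite -addnA.
by under eq_set do under eq_set do under eq_set do rewrite addnA.
Qed.

Lemma near_uadd (p q : set_system nat) (P : nat -> Prop) :
  (\forall n \near uadd p q, P n) =
  (\forall n \near p, \forall m \near q, P (n + m)%N).
Proof. by []. Qed.

(* The [r + q] with [{m | 0 < m} \in r] form a left ideal. *)
Lemma minimal_uf_gt0 (q : set_system nat) : betaN0 q -> minimal_uf q ->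
  \forall m \near q, (0 < m)%N.
Proof.
move=> qU [[qsub _ _] qmin].
pose L := [set uadd r q | r in [set r | betaN0 r /\ r [set m | (0 < m)%N]]].
have Lsub : L `<=` betaN0_add q by move=> _ [r [rU _] <-]; exists r.
have Lideal : left_ideal L.
  split; first exact: subset_trans qsub.
    exists (uadd (principal_filter 1%N) q); exists (principal_filter 1%N) => //.
    by split; [exact: principal_filter_ultra|exact/principal_filterP].
  move=> p _ pU [r [rU r0] <-]; exists (uadd p r); last by rewrite uaddA.
  split; first exact: uadd_betaN0.
  have {}pU : UltraFilter p := pU; have {}rU : UltraFilter r := rU.
  rewrite -[_ _]/(\forall m \near uadd p r, (0 < m)%N) near_uadd; near=> n.
  by apply: filterS r0 => m m0; rewrite addn_gt0 m0 orbT.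
have : L q.
  rewrite (qmin L Lideal Lsub); exists (principal_filter 0%N).
    exact: principal_filter_ultra.
  by apply/seteqP; split=> E; rewrite /uadd /= principal_filterP.
case=> r [rU r0] <-; have {}rU : UltraFilter r := rU.
have {}qU : UltraFilter q := qU.
by rewrite near_uadd; apply: filterS r0 => n n0; near=> m; rewrite addn_gt0 n0.
Unshelve. all: by end_near. Qed.

(** By idempotency it suffices to look at sums of an [m > n] and an [l > 0], and these exceed
    [n + 1]. *)
Lemma idempotent_infty (q : set_system nat) : UltraFilter q -> uadd q q = q ->
  (\forall m \near q, (0 < m)%N) -> forall n, \forall m \near q, (n < m)%N.
Proof.
move=> qU qq q0; elim=> // n IH; rewrite (uadd_near _ qq).
apply: filterS IH => m nm; apply: filterS q0 => l l0.
by rewrite -addn1; apply: leq_add.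
Qed.

Section Torus.
Context {R : realType} {d : nat}.
Implicit Types v a : 'rV[R]_d.

Lemma intvecD v a : intvec v -> intvec a -> intvec (v + a).
Proof. by move=> vZ aZ i; rewrite mxE rpredD. Qed.

Lemma intvecN v : intvec v -> intvec (- v).
Proof. by move=> vZ i; rewrite mxE rpredN. Qed.

Lemma intvecZ n v : intvec v -> intvec (n%:R *: v).
Proof. by move=> vZ i; rewrite mxE rpredM ?natr_int. Qed.

Lemma fracv_intvec v : intvec (fracv v - v).
Proof. by move=> i; rewrite !mxE addrAC subrr add0r rpredN intr_int. Qed.

Lemma fracv_cube v : unit_cube (fracv v).
Proof.
move=> i; rewrite mxE subr_ge0 floor_le_tmp ltrBlDl.
by rewrite -[X in _ + X]/(1%:~R) -intrD floorD1_gt.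
Qed.

Lemma fracv_eq v a : unit_cube a -> intvec (a - v) -> fracv v = a.
Proof.
move=> ac av; apply/rowP => i; apply/eqP; rewrite -subr_eq0 -[_ == 0]negbK.
apply/negP => h; have /andP[a0 a1] := ac i; have /andP[f0 f1] := fracv_cube v i.
have fZ : fracv v 0 i - a 0 i \is a Num.int.
  rewrite (_ : _ - _ = (fracv v - v) 0 i - (a - v) 0 i); last by rewrite !mxE; ring.
  by apply: rpredB; [exact: fracv_intvec|exact: av].
have := norm_intr_ge1 fZ h; apply/negP; rewrite -ltNge ltr_norml; lra.
Qed.

Lemma cube_flim (q : set_system nat) (z : nat -> 'rV[R]_d) : UltraFilter q ->
  (forall m, unit_cube (z m)) ->
  exists l : 'rV[R]_d, forall i, flim q (fun m => z m 0 i) (l 0 i).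
Proof.
move=> qU zc.
have /choice[l lE] : forall i, exists l, flim q (fun m => z m 0 i) l.
  move=> i; apply: (ultra_flim (M := 1)); near=> m.
  by have /andP[h1 h2] := zc m i; rewrite ger0_norm // ltW.
by exists (\row_i l i) => i; rewrite mxE.
Unshelve. all: by end_near. Qed.

(** The vectors [x^(n+m) - k^n x^m] are integral; since they converge along [q], almost all of them
    equal the limit [w n - k^n y]. *)
Lemma orbit_structure (q : set_system nat) k (x0 : 'rV[R]_d) : UltraFilter q ->
  exists (y : 'rV[R]_d) (w : nat -> 'rV[R]_d),
    [/\ forall i, flim q (fun m => orbit_pt k x0 m 0 i) (y 0 i),
        forall n, \forall m \near q,
          orbit_pt k x0 (n + m) = w n + (k ^ n)%:R *: (orbit_pt k x0 m - y) &
        forall n, intvec (w n - (k ^ n)%:R *: y)].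
Proof.
move=> qU; have FF : Filter q by typeclasses eauto.
have [y yE] := cube_flim qU (fun m => fracv_cube ((k ^ m)%:R *: x0)).
have /choice[w wE] : forall n, exists l : 'rV[R]_d,
    forall i, flim q (fun m => orbit_pt k x0 (n + m) 0 i) (l 0 i).
  by move=> n; apply: cube_flim => m; exact: fracv_cube.
have xZ n m : intvec (orbit_pt k x0 (n + m) - (k ^ n)%:R *: orbit_pt k x0 m).
  rewrite (_ : _ - _ = (orbit_pt k x0 (n + m) - (k ^ (n + m))%:R *: x0) -
    (k ^ n)%:R *: (orbit_pt k x0 m - (k ^ m)%:R *: x0)).
    apply: intvecD; first exact: fracv_intvec.
    by apply/intvecN/intvecZ/fracv_intvec.
  by apply/rowP => i; rewrite !mxE expnD natrM; ring.
have xw n : \forall m \near q,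
    orbit_pt k x0 (n + m) - (k ^ n)%:R *: orbit_pt k x0 m = w n - (k ^ n)%:R *: y.
  have : \forall m \near q, forall i,
      (orbit_pt k x0 (n + m) - (k ^ n)%:R *: orbit_pt k x0 m) 0 i =
      (w n - (k ^ n)%:R *: y) 0 i.
    apply: filter_forall => i; apply: flim_int => [m|]; first exact: xZ.
    have := flimD FF (wE n i) (flimM FF (flim_cst (- (k ^ n)%:R) FF) (yE i)).
    rewrite mulNr (_ : _ - _ = (w n - (k ^ n)%:R *: y) 0 i); last by rewrite !mxE.
    by apply: flim_near; near=> m; rewrite !mxE mulNr.
  by apply: filterS => m h; apply/rowP.
exists y, w; split=> // n.
  apply: filterS (xw n) => m h; rewrite scalerBr addrCA -h.
  by rewrite [RHS]addrC subrK.
by have [m <-] := filter_ex (xw n); exact: xZ.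
Unshelve. all: by end_near. Qed.

(** The multiples of [y] by the partial sums [s j] converge modulo 1 along [q], so two of them are
    close, and [s j' - s j] is again a finite sum of the sequence. *)
Lemma IP_set_return (A : set nat) (y : 'rV[R]_d) (q : set_system nat) delta T :
  UltraFilter q -> (forall n, \forall m \near q, (n < m)%N) -> IP_set A -> 0 < delta ->
  exists h c, [/\ A h, (T < h)%N, intvec (c - h%:R *: y) & forall i, `|c 0 i| < delta].
Proof.
move=> qU qinf [u [u0 Au]] delta0.
pose s j := (\sum_(0 <= i < j) u i)%N.
have [l lE] := cube_flim qU (fun j => fracv_cube ((s j)%:R *: y)).
have near_l : \forall j \near q, forall i,
    `|fracv ((s j)%:R *: y) 0 i - l 0 i| < delta / 2.
  by apply: filter_forall => i; apply: lE; rewrite divr_gt0.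
have [j hj] := filter_ex near_l.
(* More than [T] terms, each at least 1, sum to more than [T]. *)
have [j' [/= hj' jj']] := filter_ex (filterI near_l (qinf (j + T)%N)).
have lejj' : (j <= j')%N by rewrite (leq_trans (leq_addr T j)) // ltnW.
pose h := (\sum_(j <= i < j') u i)%N.
have sh : s j' = (s j + h)%N by rewrite /s /h (big_cat_nat (n := j)).
exists h, (fracv ((s j')%:R *: y) - fracv ((s j)%:R *: y)); split.
- pose F := [fset i in index_iota j j']%fset.
  rewrite /h (_ : (\sum_(j <= i < j') u i = \sum_(i <- F) u i)%N).
    apply: Au; apply/fset0Pn; exists j.
    by rewrite !inE mem_index_iota leqnn (leq_ltn_trans (leq_addr T j)).
  apply: perm_big; apply: uniq_perm; rewrite ?iota_uniq ?fset_uniq //.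
  by move=> i; rewrite !inE.
- have : (j' - j <= h)%N.
    rewrite -[X in (X <= _)%N]muln1 -sum_nat_const_nat; exact: leq_sum.
  by apply: leq_trans; rewrite ltn_subRL.
- rewrite (_ : _ - _ = (fracv ((s j')%:R *: y) - (s j')%:R *: y) -
    (fracv ((s j)%:R *: y) - (s j)%:R *: y)).
    by apply: intvecD; [|apply: intvecN]; exact: fracv_intvec.
  by rewrite sh natrD; apply/rowP => i; rewrite !mxE; ring.
move=> i; rewrite !mxE.
have := hj i; have := hj' i; rewrite !mxE !ltr_norml => /andP[? ?] /andP[? ?].
by apply/andP; split; lra.
Qed.

End Torus.

Section Shift.
Context {R : realType} {d k : nat} {q : set_system nat}.
Hypotheses (k_gt1 : (1 < k)%N) (qU : UltraFilter q) (q_idem : uadd q q = q).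
Variables (x w : nat -> 'rV[R]_d) (y : 'rV[R]_d).
Hypothesis x_lim : forall i, flim q (fun m => x m 0 i) (y 0 i).
Hypothesis xw : forall n, \forall m \near q,
  x (n + m)%N = w n + (k ^ n)%:R *: (x m - y).

(** By idempotency some [x (n + m + l)] can be expanded both from [n + m] and from [n]; the terms in
    [x l - y] cancel. *)
Lemma orbit_shift : shift_orbit (q := q) (k := k) (fun m => w m - y) w.
Proof.
move=> n; have := xw n; rewrite (uadd_near _ q_idem) => xwn.
have : \forall m \near q, \forall l \near q, x (n + m + l)%N =
    w (n + m)%N + (k ^ (n + m))%:R *: (x l - y) /\ x (m + l)%N = w m + (k ^ m)%:R *: (x l - y).
  by near=> m; near=> l; split; near: l; exact: xw.
apply: filterS2 xwn => m h1 h2.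
have [l [/= e1 [e2 e3]]] := filter_ex (filterI h1 h2).
move: e1; rewrite addnA e2 e3 => /(congr1 (fun v => v - (k ^ (n + m))%:R *: (x l - y))).
rewrite addrK => ->; apply/rowP => i; rewrite !mxE expnD natrM; ring.
Unshelve. all: by end_near. Qed.

(** [w m - y] equals [(x (m + l) - y) - k^m (x l - y)]; [l] is chosen after [m], so the tolerance
    for [x l - y] may depend on [k^m]. *)
Lemma orbit_shift_lim i : flim q (fun m => (w m - y) 0 i) 0.
Proof.
move=> e e0; have e2 : 0 < e / 2 by rewrite divr_gt0.
have := x_lim i e2; rewrite (uadd_near _ q_idem); apply: filterS => m h1.
have km0 : 0 < (k ^ m)%:R :> R by rewrite ltr0n expn_gt0 (ltnW k_gt1).
have h2 := x_lim i (divr_gt0 e2 km0).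
have [l [/= [a b] c]] := filter_ex (filterI (filterI h1 h2) (xw m)).
move: a b; rewrite (ltr_pdivlMr _ _ km0) c !mxE subr0 => a b.
have -> : w m 0 i - y 0 i = (w m 0 i + (k ^ m)%:R * (x l 0 i - y 0 i) - y 0 i)
  - (x l 0 i - y 0 i) * (k ^ m)%:R by ring.
apply: le_lt_trans (ler_normB _ _) _; rewrite [X in _ + X]normrM.
rewrite (gtr0_norm km0); lra.
Qed.

End Shift.

(** * Semialgebraic sets and the conclusion *)

Lemma sgr_eq_transfer (R : realDomainType) (a b : R) : Num.sg a = Num.sg b ->
  [/\ (b = 0) -> (a = 0), (0 < b) -> (0 < a) & (0 <= b) -> (0 <= a)].
Proof.
move=> ab; split; last by rewrite -sgr_ge0 -ab sgr_ge0.
  by move/eqP; rewrite -sgr_eq0 -ab sgr_eq0 => /eqP.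
by rewrite -sgr_gt0 -ab sgr_gt0.
Qed.

Lemma semialgebraic_transfer (R : realType) d (S : set 'rV[R]_d) : S `<=` unit_cube (d:=d) ->
  semialgebraic S -> exists fs : seq {mpoly R[d]}, forall a b : 'rV[R]_d,
    (forall f, f \in fs -> Num.sg (ev f a) = Num.sg (ev f b)) ->
    S b -> S a /\ unit_cube a.
Proof.
move=> Scube [s sE].
pose coords := [seq 'X_i | i <- enum 'I_d] : seq {mpoly R[d]}.
(* Besides the defining polynomials, the signs of [X_i] and [1 - X_i] are recorded; they detect the
   half-open cube. *)
exists (flatten [seq c.1 ++ c.2 | c <- s] ++ (coords ++ [seq 1 - X | X <- coords])).
move=> a b ab Sb; split.
  move: Sb; rewrite {1}sE => -[c cs [ceq cpos]]; rewrite sE; exists c => //.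
  have {}ab f : f \in c.1 ++ c.2 -> Num.sg (ev f a) = Num.sg (ev f b).
    by move=> fc; apply: ab; rewrite mem_cat; apply/orP; left; apply/flatten_mapP; exists c.
  split=> f fc.
    have [|+ _ _] := sgr_eq_transfer (ab f _); first by rewrite mem_cat fc.
    by apply; exact: ceq.
  have [|_ + _] := sgr_eq_transfer (ab f _); first by rewrite mem_cat fc orbT.
  by apply; exact: cpos.
move=> i; have /andP[b0 b1] := Scube _ Sb i.
have Xi : 'X_i \in coords by apply: map_f; rewrite mem_enum.
apply/andP; split.
  have [|_ _] := sgr_eq_transfer (ab 'X_i _); last by rewrite !mevalXU; apply.
  by rewrite !mem_cat Xi orbT.
have [|_ + _] := sgr_eq_transfer (ab (1 - 'X_i) _).
  by rewrite !mem_cat (map_f (fun X => 1 - X) Xi) !orbT.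
by rewrite !mevalB !meval1 !mevalXU !subr_gt0; apply.
Qed.

(** The spaces from [vanishing_directions] are intersected over [Bs]. They are taken for [t *: e m],
    which satisfies the same recurrence; scaling by [t^-1] returns to [e m]. *)
Lemma persistent_zeros (R : realType) d k (q : set_system nat) (e : nat -> 'rV[R]_d)
    (Bs : seq {mpoly R[d]}) (t : R) (w0 : 'rV[R]_d) :
  (1 < k)%N -> UltraFilter q -> uadd q q = q ->
  (forall n, \forall m \near q, (n < m)%N) ->
  (forall i, flim q (fun m => e m 0 i) 0) -> shift_orbit (q := q) (k := k) e e ->
  t != 0 ->
  exists K, [/\ linear_set K, \forall m \near q, K (e m) &
    forall B v, B \in Bs -> K v -> (\forall m \near q, ev B (w0 + t *: e m) = 0) ->
      ev B (w0 + v) = 0].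
Proof.
move=> k1 qU qq qinf elim ee t0; have FF : Filter q by typeclasses eauto.
have te_lim i : flim q (fun m => (t *: e m) 0 i) 0.
  have := flimM FF (flim_cst t FF) (elim i); rewrite mulr0.
  by apply: flim_near; near=> m; rewrite mxE.
have te_shift : shift_orbit (q := q) (k := k) (fun m => t *: e m) (fun m => t *: e m).
  by move=> n; apply: filterS (ee n) => m ->; rewrite scalerDr !scalerA mulrC.
have /choice[K KE] := fun B : {mpoly R[d]} => vanishing_directions k1 qU qq qinf te_lim B te_shift.
exists (fun v => forall B, B \in Bs -> K B v); split.
- split.
  + by move=> B _; have [[]] := KE B.
  + by move=> u v Ku Kv B BBs; have [[_ KD _] _ _] := KE B; apply: KD; auto.
  + by move=> s v Kv B BBs; have [[_ _ KZ] _ _] := KE B; apply: KZ; auto.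
- apply: near_all_in => B _; have [[_ _ KZ] Kte _] := KE B.
  by apply: filterS Kte => m /(KZ t^-1); rewrite scalerA mulVf // scale1r.
move=> B v BBs Kv B0; have [_ _ H] := KE B; apply: H; first exact: Kv.
by apply: filterS B0 => m; rewrite addrC.
Unshelve. all: by end_near. Qed.

Theorem theorem3p8 (R : realType) (d k : nat) (hd : (1 <= d)%N) (hk : (2 <= k)%N)
    (x0 : 'rV[R]_d) (hx0 : unit_cube x0)
    (q : set_system nat) (hq : betaN0 q)
    (q_idem : idempotent_uf q) (q_min : minimal_uf q)
    (p : set_system nat) (hp : betaN0_add q p)
    (S : set 'rV[R]_d) (hS : S `<=` @unit_cube R d) (S_sa : semialgebraic S)
    (hpS : p [set n | S (orbit_pt k x0 n)]) :
  IP_star_plus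
    [set l : nat | (0 < l)%N /\
                   q [set n | S (fracv (l%:R *: orbit_pt k x0 n))]].
Proof.
have qU : UltraFilter q := hq.
have qinf := idempotent_infty qU q_idem (minimal_uf_gt0 hq q_min).
have [pU pq] : UltraFilter p /\ uadd p q = p.
  case: hp => r rU <-; split; first exact: uadd_betaN0.
  by rewrite uaddA q_idem.
pose x := orbit_pt k x0.
have [y [w [x_lim xw wy]]] := orbit_structure k x0 qU.
pose e m := w m - y; pose eps m := x m - y.
have ww : shift_orbit (q := q) (k := k) e w := orbit_shift qU q_idem xw.
have e_lim : forall i, flim q (fun m => e m 0 i) 0 := orbit_shift_lim hk qU q_idem x_lim xw.
have ee : shift_orbit (q := q) (k := k) e e.
  by move=> n; apply: filterS (ww n) => m; rewrite /e => ->; rewrite addrAC.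
have [fs fsP] := semialgebraic_transfer hS S_sa.
have /choice[Bs BsP] := fun f => sign_transfer hk qU qinf e_lim pU pq ww f eps.
pose Ball := flatten [seq Bs f | f <- fs].
have near_sg : \forall n \near p, forall f, f \in fs -> \forall m \near q,
    Num.sg (ev f (w n + (k ^ n)%:R *: eps m)) = lexat (Bs f) (w n).
  by apply: near_all_in => f _; have [] := BsP f.
have near_zero : \forall n \near p, forall B, B \in Ball -> ev B (w n) = 0 ->
    \forall m \near q, ev B (w (n + m)%N) = 0.
  apply: near_all_in => B _.
  have [z|nz] := ultra_near (fun n => ev B (w n) = 0) pU.
    by move: z; rewrite (uadd_near _ pq); apply: filterS.
  by apply: filterS nz => n h /h.
have near_S : \forall n \near p, \forall m \near q, S (x (n + m)%N).
  by rewrite -(uadd_near (fun n => S (x n)) pq).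
have [n [[/= n_sg n_zero] n_S]] := filter_ex (filterI (filterI near_sg near_zero) near_S).
have kn0 : (k ^ n)%:R != 0 :> R by rewrite pnatr_eq0 expn_eq0 -leqn0 leqNgt (ltnW hk).
have [K [Klin Ke K0]] := persistent_zeros Ball (w n) hk qU q_idem qinf e_lim ee kn0.
have [|delta1 delta1_gt0 K_small] := linear_set_discrete hk qU qinf e_lim Klin Ke (y := y).
  move=> m; rewrite (_ : _ - _ = w m - (k ^ m)%:R *: y) //.
  by apply/rowP => i; rewrite !mxE; ring.
have : \forall z \near near_infty (w n), forall f, f \in fs ->
    zeros_persist (Bs f) (w n) z.1 ->
    \forall m \near q, Num.sg (ev f (z.1 + z.2 *: eps m)) = lexat (Bs f) (w n).
  have FF := near_infty_filter (w n).
  by apply: near_all_in => f _; have [_ h] := BsP f; exact: h.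
case=> delta2 [M [delta2_gt0 near_a]].
(* The translated set contains [h] exactly when [k^n + h] is in the original one. *)
exists (- (k ^ n)%:Z) => A IPA.
have delta_gt0 : 0 < Num.min delta1 delta2 by rewrite lt_min delta1_gt0.
(* The lower bound on [h] makes [k^n + h] exceed [M]; [delta1] puts [c] in [K] and [delta2] keeps
   [w n + c] near [w n]. *)
have [h [c [Ah hM cy c_small]]] :=
  IP_set_return y (Num.truncn `|M|).+1 qU qinf IPA delta_gt0.
exists h; split=> //; exists (k ^ n + h)%N; last by rewrite PoszD addrAC subrr add0r.
split; first by rewrite addn_gt0 expn_gt0 (ltnW hk).
have Kc : K c.
  by apply: K_small cy _ => i; apply: lt_le_trans (c_small i) _; rewrite ge_min lexx.
have sg_a : \forall m \near q, forall f, f \in fs ->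
    Num.sg (ev f (w n + c + (k ^ n + h)%:R *: eps m)) = lexat (Bs f) (w n).
  apply: near_all_in => f ffs.
  apply: (near_a (w n + c) (k ^ n + h)%:R _ _ f ffs).
  - move=> i; rewrite mxE addrAC subrr add0r.
    by apply: lt_le_trans (c_small i) _; rewrite ge_min lexx orbT.
  - apply: le_lt_trans (ler_norm M) _; apply: lt_trans (truncnS_gt _) _.
    by rewrite ltr_nat (leq_trans hM) // leq_addl.
  move=> B BBs B0; have BBall : B \in Ball by apply/flatten_mapP; exists f.
  apply: K0 => //; apply: filterS2 (ww n) (n_zero B BBall B0) => m; rewrite /e => ->.
  by [].
have n_sg' : \forall m \near q, forall f, f \in fs ->
    Num.sg (ev f (x (n + m)%N)) = lexat (Bs f) (w n).
  apply: near_all_in => f ffs.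
  by apply: filterS2 (xw n) (n_sg f ffs) => m; rewrite /x => ->.
(* The signs at the perturbed point agree with those at [x (n + m)] in [S], so it lies in [S] and in
   the cube; being congruent to [(k^n + h) x m], it is the fractional part of that vector. *)
apply: filterS3 sg_a n_sg' n_S => m h1 h2 /=.
case/(fsP (w n + c + (k ^ n + h)%:R *: eps m)) => [f ffs|Sa a_cube].
  by rewrite h1 // h2.
rewrite (fracv_eq a_cube) // (_ : _ - _ = (w n - (k ^ n)%:R *: y) + (c - h%:R *: y)).
  exact: intvecD.
by apply/rowP => i; rewrite !mxE natrD; ring.
Qed.
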